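(* Let $B_M\subseteq\{0,1\}^n$ be a fixed nonempty set with $N_M=|B_M|$, and let ansatz measurement outcomes be i.i.d. uniform random elements of $\{0,1\}^n$. Let $M_I$ be the random number of outcomes drawn until every element of $B_M$ has appeared at least once. Then $$\mathbb E[M_I]=2^n H_{N_M},\qquad H_{N_M}=\sum_{i=1}^{N_M}\frac1i .$$ Moreover, for any $\delta\in(0,1)$, if a number of ansatz shots $M\ge 2^n\log(N_M/\delta)$ is taken and $B_a$ denotes the set of outcomes observed in these shots, then $B_M\subseteq B_a$ holds with probability at least $1-\delta$. In particular, if $N_M$ grows exponentially with $n$ (i.e. for a family of sets $B_M=B_M^{(n)}$ with $N_M\ge a^n$ for some constant $a>1$ and all large $n$), then any number of shots $M=M(n)$ for which $\Pr(B_M\subseteq B_a)$ is non-negligible (bounded below by an inverse polynomial in $n$ for all large $n$) must be exponentially large, i.e. $M(n)\ge b^n$ for some constant $b>1$ and all large $n$.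
   Context: $\log$ is the natural logarithm. $n\ge 1$ is the number of qubits; $B_a$ is the (random) set of distinct bit strings observed among the ansatz shots taken. *)

(* Defs.v *)
From mathcomp Require Export all_boot all_order all_algebra.
From mathcomp Require Export all_classical all_reals all_analysis.
Set Implicit Arguments.
Unset Strict Implicit.
Unset Printing Implicit Defensive.
Import Order.TTheory GRing.Theory Num.Theory.
Local Open Scope classical_set_scope.
Local Open Scope ring_scope.

(* With the product sigma-algebra over the discrete one on bool, every subset
   of n.-tuple bool is measurable. *)
Notation bitstring n := (n.-tuple bool).

Definition mutually_independent (R : realType) (d d' : measure_display)
    (T : measurableType d) (T' : measurableType d') (P : probability T R)
    (X : nat -> {RV P >-> T'}) : Prop :=
  forall (J : seq nat) (A : nat -> set T'),
    uniq J -> (forall i, measurable (A i)) ->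
    P (\big[setI/setT]_(i <- J) (X i @^-1` A i)) =
      (\prod_(i <- J) P (X i @^-1` A i))%E.

Definition iid_uniform (R : realType) (n : nat) (d : measure_display)
    (T : measurableType d) (P : probability T R)
    (X : nat -> {RV P >-> bitstring n}) : Prop :=
  mutually_independent X /\
  forall (i : nat) (x : bitstring n),
    distribution P (X i) [set x] = ((2 ^+ n)^-1)%:E.

Definition observed (n : nat) (T : Type) (X : nat -> T -> bitstring n)
    (M : nat) (w : T) : {set bitstring n} :=
  [set X (val i) w | i : 'I_M]%SET.

(* Extended-real valued: the infimum of the empty set is +oo, so the value is
   +oo when some element of B never appears. *)
Definition collection_time (R : realType) (n : nat) (T : Type)
    (X : nat -> T -> bitstring n) (B : {set bitstring n}) (w : T) : \bar R :=
  ereal_inf [set (k%:R)%:E | k in [set k : nat | B \subset observed X k w]].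

Definition harmonic_number (R : realType) (N : nat) : R :=
  \sum_(1 <= i < N.+1) (i%:R)^-1.

(* Eventual positivity of the polynomial is required because x^-1 is total
   (and 0^-1 = 0). *)
Definition non_negligible (R : realType) (q : nat -> \bar R) : Prop :=
  exists p : {poly R}, \forall n \near \oo,
    0 < p.[n%:R] /\ ((p.[n%:R]^-1)%:E <= q n)%E.

(* Main.v *)
Require Import Defs.
From mathcomp Require Import all_boot all_order all_algebra.
From mathcomp Require Import all_classical all_reals all_analysis.
From mathcomp Require Import measurable_realfun ring.
Import Order.TTheory GRing.Theory Num.Theory.
Import numFieldNormedType.Exports.
Local Open Scope classical_set_scope.
Local Open Scope ring_scope.

(** Conditioning on the first outcome, the probability u_k(m) that k draws miss
    part of a set of m strings, among N = 2^n, satisfies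
      N u_(k+1)(m) = (N - m) u_k(m) + m u_k(m - 1).
    By induction, sum_(k < K) u_k(m) = sum_(1 <= i <= m) (N / i) (1 - u_K(i)) and
    u_k(m) <= m (1 - 1/N)^k. As E[M_I] = sum_k P(M_I > k) = sum_k u_k(N_M), letting
    K go to infinity gives the expectation; 1 - 1/N <= exp(-1/N) gives the tail
    bound. The last claim needs only P(B_M <= B_a) > 0: some sample of M outcomes
    then covers B_M, so M >= N_M. *)

(** * The miss probabilities: recurrence, bound and limits *)

(** At [m = 0] the truncated [m.-1] is again 0, which does no harm because its coefficient
    vanishes. *)
Fixpoint miss_prob (R : realType) (N : R) (k m : nat) : R :=
  if k is k'.+1 then
    ((N - m%:R) * miss_prob R N k' m + m%:R * miss_prob R N k' m.-1) / N
  else (m != 0)%:R.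
Arguments miss_prob {R} N k m.

Lemma miss_prob0 (R : realType) (N : R) (k : nat) : miss_prob N k 0 = 0.
Proof. by elim: k => //= k ->; rewrite mul0r mulr0 addr0 mul0r. Qed.

Lemma miss_prob_ge0 (R : realType) (N : R) (k m : nat) :
  m%:R <= N -> 0 <= miss_prob N k m.
Proof.
elim: k m => [//|k IH] m mN /=.
have N0 : 0 <= N by exact: le_trans mN.
rewrite divr_ge0// addr_ge0// mulr_ge0 ?subr_ge0 ?IH//.
by rewrite (le_trans _ mN)// ler_nat leq_pred.
Qed.

(** This is the union bound: each of the m strings is avoided by k draws with probability (1 -
    1/N)^k. *)
Lemma miss_prob_le (R : realType) (N : R) (k m : nat) :
  0 < N -> m%:R <= N -> miss_prob N k m <= m%:R * (1 - N^-1) ^+ k.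
Proof.
move=> N0; elim: k m => [|k IH] [|m] mN; rewrite ?miss_prob0 ?mul0r//.
  by rewrite expr0 mulr1 /= ler1n.
have mN' : m%:R <= N by rewrite (le_trans _ mN)// ler_nat.
have H1 := IH _ mN; have H2 := IH _ mN'.
rewrite [miss_prob _ _ _]/= ler_pdivrMr//.
apply: (@le_trans _ _ ((N - m.+1%:R) * (m.+1%:R * (1 - N^-1) ^+ k)
   + m.+1%:R * (m%:R * (1 - N^-1) ^+ k))).
  by apply: lerD; apply: ler_wpM2l => //; rewrite subr_ge0.
(* The two sides agree, since (N - (m+1)) (m+1) + (m+1) m = (m+1) (N - 1) and N (1 - 1/N) = N -
   1. *)
rewrite le_eqVlt; apply/orP; left; apply/eqP.
rewrite exprS -(natr1 m); field; exact: lt0r_neq0.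
Qed.

(** For m >= 1 the recurrence reads u_k(m) - u_k(m - 1) = (N / m) (u_k(m) - u_(k+1)(m)). The right
    side telescopes in k from u_0(m) = 1; summing over m gives the harmonic weights. *)
Lemma sum_miss_prob (R : realType) (N : R) (K m : nat) : N != 0 ->
  \sum_(0 <= k < K) miss_prob N k m =
  \sum_(1 <= i < m.+1) N / i%:R * (1 - miss_prob N K i).
Proof.
move=> N0; elim: m => [|m IH].
  by rewrite [RHS]big_geq// big1// => k _; exact: miss_prob0.
rewrite [RHS]big_nat_recr//= -IH {IH}.
have m0 : (1 + m)%:R != 0 :> R by [].
elim: K => [|K IH]; first by rewrite !big_geq//= subrr mulr0 add0r.
rewrite 2?big_nat_recr//= IH.
by field; rewrite N0 nat1r m0.
Qed.

Lemma cvg_miss_prob (R : realType) (N : R) (m : nat) :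
  1 <= N -> m%:R <= N -> miss_prob N k m @[k --> \oo] --> 0.
Proof.
move=> N1 mN; have N0 : 0 < N by exact: lt_le_trans N1.
apply: (squeeze_cvgr (f := cst 0) (h := fun k => m%:R * (1 - N^-1) ^+ k)).
- by near=> k; rewrite miss_prob_ge0// miss_prob_le.
- exact: cvg_cst.
- rewrite -(mulr0 m%:R); apply: cvgM; first exact: cvg_cst.
  apply: cvg_expr; rewrite ger0_norm ?subr_ge0 ?invf_le1//.
  by rewrite ltrBlDr ltrDl invr_gt0.
Unshelve. all: end_near. Qed.

Lemma cvg_sum_miss_prob (R : realType) (N : R) (m : nat) :
  1 <= N -> m%:R <= N ->
  \sum_(0 <= k < K) miss_prob N k m @[K --> \oo] --> N * harmonic_number R m.
Proof.
move=> N1 mN; have N0 : N != 0 by rewrite gt_eqF// (lt_le_trans _ N1).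
under eq_fun do rewrite sum_miss_prob//.
elim: m mN => [|m IH] mN.
  rewrite /harmonic_number big_geq// mulr0.
  by under eq_fun do rewrite big_geq//; exact: cvg_cst.
under eq_fun do rewrite big_nat_recr//.
rewrite /harmonic_number big_nat_recr// mulrDr.
apply: cvgD; first by apply: IH; rewrite (le_trans _ mN)// ler_nat.
rewrite -[X in _ --> X]mulr1; apply: cvgM; first exact: cvg_cst.
rewrite -[X in _ --> X]subr0; apply: cvgB; first exact: cvg_cst.
exact: cvg_miss_prob.
Qed.

(** * Hitting times, measurable singletons and set covering *)

(** A predicate that stays true once true fails exactly at the times before its first success, so
    counting failures gives that time. If it never holds, both sides are +oo. *)
Lemma ereal_inf_nat (R : realType) (b : pred nat) :
  (forall k, b k -> b k.+1) ->
  ereal_inf [set (k%:R : R)%:E | k in [set k | b k]] =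
  (\sum_(0 <= k <oo) (~~ b k)%:R%:E)%E.
Proof.
move=> bS; have b_homo i j : (i <= j)%N -> b i -> b j.
  by move=> /subnK <-; elim: (j - i)%N => // l IH /IH; exact: bS.
have sum_lt l : (forall k, (k < l)%N -> ~~ b k) ->
    \sum_(0 <= k < l) (~~ b k)%:R%:E = (l%:R : R)%:E.
  move=> nb; rewrite big_nat (eq_bigr (fun=> 1%:E)).
    by rewrite -big_nat sumEFin sumr_const_nat subn0.
  by move=> k /andP[_ kl]; rewrite nb.
have ge0 k : (0%N <= k)%N -> true -> (0 <= (~~ b k)%:R%:E :> \bar R)%E.
  by rewrite lee_fin.
have [[k0 bk0]|nb] := pselect (exists k, b k); last first.
  have nb' k : ~~ b k by apply/negP => bk; apply: nb; exists k.
  have -> : [set k | b k] = set0.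
    by rewrite -subset0 => k /=; rewrite (negbTE (nb' k)).
  rewrite image_set0 ereal_inf0; apply/esym/eqyP => x x0.
  (* All terms are 1 here, and this many of them already sum to more than x. *)
  apply: le_trans (nneseries_lim_ge (Num.truncn x).+1 ge0).
  by rewrite sum_lt// lee_fin ltW// truncnS_gt.
have exb : exists k, b k by exists k0.
case: (ex_minnP exb) => m bm mmin.
transitivity (m%:R%:E : \bar R).
  apply/eqP; rewrite eq_le; apply/andP; split.
    by apply: ereal_inf_lbound; exists m.
  by apply: le_ereal_inf_tmp => _ [k /= bk <-]; rewrite lee_fin ler_nat mmin.
rewrite (nneseries_split 0 m) => [|k _]; last exact: ge0.
rewrite add0n sum_lt; last first.
  by move=> k; rewrite ltnNge; apply: contra; exact: mmin.
rewrite eseries0 ?adde0// => k mk _.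
by rewrite (b_homo _ _ mk bm).
Qed.

(** In the product sigma-algebra a point is a finite intersection of coordinate conditions. *)
Lemma measurable_bitstring1 (n : nat) (x : bitstring n) : measurable [set x].
Proof.
have -> : [set x] = \bigcap_(i in [set: 'I_n])
    ((fun t : bitstring n => tnth t i) @^-1` [set tnth x i]).
  apply/seteqP; split=> [_ -> //|t /= tx].
  by apply: eq_from_tnth => i; exact: tx.
apply: fin_bigcap_measurable => // i _.
by rewrite -[X in measurable X]setTI; exact: measurable_tnth.
Qed.

(** This is the source of the recurrence: after a first outcome x, the remaining draws have to cover
    B without x, one string fewer exactly when x lies in B. *)
Lemma setD1_subset_cons (A : finType) (B : {set A}) (x : A) (s : seq A) :
  (B \subset x :: s) = (B :\ x \subset s).
Proof.
apply/fintype.subsetP/fintype.subsetP => [H y|H y yB].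
  by rewrite !inE => /andP[/negbTE yx /H]; rewrite inE yx.
by have := H y; rewrite !inE yB; case: eqP => //= _; exact.
Qed.

(** * Events determined by consecutive draws *)

Section draws.
Context (R : realType) (n : nat) (d : measure_display) (T : measurableType d)
  (P : probability T R) (X : nat -> {RV P >-> bitstring n}).

(** The offset [j] allows the first outcome to be split off, and the order is kept so that prefixes
    have a joint law. *)
Definition draws (j k : nat) (w : T) : seq (bitstring n) :=
  [seq X i w | i <- iota j k].

Lemma measurable_fiber (j : nat) (x : bitstring n) :
  measurable (X j @^-1` [set x]).
Proof.
by rewrite -[X in measurable X]setTI; apply: measurable_funPT => //;
  exact: measurable_bitstring1.
Qed.

Lemma bigcup_fiber (j : nat) (D : set T) :
  D = \bigcup_(x in [set: bitstring n]) (D `&` X j @^-1` [set x]).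
Proof.
by apply/seteqP; split => [w Dw|w [x _ []]//]; exists (X j w).
Qed.

Lemma measurable_by_fiber (j : nat) (D : set T) :
  (forall x, measurable (D `&` X j @^-1` [set x])) -> measurable D.
Proof.
by move=> mD; rewrite (bigcup_fiber j D); apply: fin_bigcup_measurable.
Qed.

(** The law of total probability over the finitely many values of the [j]-th outcome. *)
Lemma measure_by_fiber (j : nat) (D : set T) :
  (forall x, measurable (D `&` X j @^-1` [set x])) ->
  P D = (\sum_(x : bitstring n) P (D `&` X j @^-1` [set x]))%E.
Proof.
move=> mD; rewrite {1}(bigcup_fiber j D) measure_fin_bigcup//.
  rewrite -big_enum -[RHS]/(\sum_(x <- enum _) _)%R [RHS]fsbig_seq ?enum_uniq//=.
  rewrite (_ : [set` enum _] = setT)//.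
  by apply/seteqP; split => x //= _; rewrite mem_enum.
- exact: finite_finset.
apply/trivIsetP => x y _ _ xy; apply/seteqP; split=> // w [[_ Ex] [_ Ey]].
by move: xy; rewrite -Ex -Ey eqxx.
Qed.

Lemma measurable_missed (j k : nat) (B : {set bitstring n}) :
  measurable [set w | ~~ (B \subset draws j k w)].
Proof.
elim: k j B => [|k IH] j B.
  rewrite /draws /=; case: (B \subset _) => /=.
    by rewrite (_ : [set _ | _] = set0)// -subset0.
  by rewrite (_ : [set _ | _] = setT)//; apply/seteqP; split.
apply: (measurable_by_fiber j) => x.
rewrite (_ : _ `&` _ = [set w | ~~ (B :\ x \subset draws j.+1 k w)] `&`
    X j @^-1` [set x]); first by apply: measurableI => //; exact: measurable_fiber.
by apply/seteqP; split => w /= [+ Xx]; rewrite /draws /= setD1_subset_cons Xx.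
Qed.

Lemma drawsS (j k : nat) (w : T) : draws j k.+1 w = X j w :: draws j.+1 k w.
Proof. by []. Qed.

Lemma draws0_rcons (k : nat) (w : T) :
  draws 0 k.+1 w = rcons (draws 0 k w) (X k w).
Proof. by rewrite /draws -addn1 iotaD map_cat cats1. Qed.

(** This puts a prefix event into the form to which [mutually_independent] applies. The all-false
    default of [nth] only makes the family of strings total; indices below [size t] never reach
    it. *)
Lemma draws_eqE (t : seq (bitstring n)) :
  [set w | draws 0 (size t) w = t] = \big[setI/setT]_(i <- iota 0 (size t))
    X i @^-1` [set nth [tuple of nseq n false] t i].
Proof.
rewrite -bigcap_seq; apply/seteqP; split => w /= H.
  move=> i /=; rewrite mem_iota /= => it.
  by rewrite -H (nth_map 0%N) ?size_iota// nth_iota.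
apply: (@eq_from_nth _ [tuple of nseq n false]); rewrite size_map size_iota// => i it.
rewrite (nth_map 0%N) ?size_iota// nth_iota//; apply: H => /=.
by rewrite mem_iota.
Qed.

Lemma measurable_draws_eq (t : seq (bitstring n)) :
  measurable [set w | draws 0 (size t) w = t].
Proof.
by rewrite draws_eqE; apply: bigsetI_measurable => i _; exact: measurable_fiber.
Qed.

Lemma subset_observed (k : nat) (B : {set bitstring n}) (w : T) :
  (B \subset observed X k w) = (B \subset draws 0 k w).
Proof.
apply: eq_subset_r => x; apply/imsetP/mapP => [[i _ ->]|[i]].
  by exists (val i) => //; rewrite mem_iota ltn_ord.
by rewrite mem_iota /= => ik ->; exists (Ordinal ik).
Qed.

Lemma measurable_not_observed (k : nat) (B : {set bitstring n}) :
  measurable [set w | ~~ (B \subset observed X k w)].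
Proof.
by under eq_set do rewrite subset_observed; exact: measurable_missed.
Qed.

Lemma collection_timeE (B : {set bitstring n}) (w : T) :
  collection_time R X B w = (\sum_(0 <= k <oo)
    (\1_[set w | ~~ (B \subset observed X k w)] w)%:E)%E.
Proof.
rewrite /collection_time ereal_inf_nat => [|k].
  apply: eq_eseriesr => k _; rewrite indicE; congr ((nat_of_bool _)%:R%:E).
  by apply/idP/idP; rewrite inE.
rewrite !subset_observed draws0_rcons => /fintype.subset_trans; apply.
by apply/fintype.subsetP => x; rewrite mem_rcons inE orbC => ->.
Qed.

(** * Probabilities and expectation for i.i.d. uniform draws *)

Hypothesis X_iid : iid_uniform X.

Lemma prob_draws_eq (t : seq (bitstring n)) :
  P [set w | draws 0 (size t) w = t] = ((2 ^+ n)^-1 ^+ size t)%:E.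
Proof.
have [Xind Xunif] := X_iid.
rewrite draws_eqE Xind ?iota_uniq// => [|i]; last exact: measurable_bitstring1.
rewrite (eq_bigr (fun=> ((2 ^+ n)^-1)%:E)) => [|i _]; last exact: Xunif.
have -> : iota 0 (size t) = index_iota 0 (size t) by rewrite /index_iota subn0.
by rewrite prodEFin big_mkord prodr_const card_ord.
Qed.

(* Fixing the first outcomes to t makes the induction on k go through: the next
   outcome extends t, so only the joint law of prefixes is needed. *)
Lemma prob_missed (t : seq (bitstring n)) (k : nat) (B : {set bitstring n}) :
  P [set w | draws 0 (size t) w = t /\ ~~ (B \subset draws (size t) k w)] =
  ((2 ^+ n)^-1 ^+ size t * miss_prob (2 ^+ n) k #|B|)%:E.
Proof.
have N0 : 2 ^+ n != 0 :> R by rewrite expf_neq0.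
elim: k t B => [|k IH] t B /=.
  have E : (B \subset [::]) = (#|B| == 0)%N.
    by rewrite cards_eq0 -finset.subset0; apply: eq_subset_r => x; rewrite !inE.
  under eq_set do rewrite [draws _ 0 _]/= E.
  case: (#|B| == 0)%N => /=.
    by rewrite mulr0 (_ : [set _ | _] = set0) ?measure0// -subset0 => w [].
  rewrite mulr1 -prob_draws_eq; congr (P _).
  by apply/seteqP; split => w //= [].
have fiberE x : [set w | draws 0 (size t) w = t /\
      ~~ (B \subset draws (size t) k.+1 w)] `&` X (size t) @^-1` [set x] =
    [set w | draws 0 (size (rcons t x)) w = rcons t x /\
      ~~ (B :\ x \subset draws (size (rcons t x)) k w)].
  rewrite size_rcons; apply/seteqP; split => w /=; rewrite draws0_rcons drawsS.
    by move=> [[-> +] Xx]; rewrite Xx setD1_subset_cons.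
  by move=> [/rcons_inj[-> ->] H]; rewrite setD1_subset_cons.
rewrite (measure_by_fiber (size t)) => [|x]; last first.
  by rewrite fiberE; apply: measurableI;
    [exact: measurable_draws_eq|exact: measurable_missed].
under eq_bigr do rewrite fiberE IH size_rcons.
rewrite sumEFin; congr EFin; rewrite -mulr_sumr exprS.
(* Each of the m next outcomes inside B leaves m - 1 strings to cover; the N - m outside leave all
   m. *)
rewrite (bigID (mem B)) /=.
rewrite (eq_bigr (fun=> miss_prob (2 ^+ n) k #|B|.-1)); last first.
  by move=> x xB; rewrite (cardsD1 x B) xB.
rewrite [X in _ + X](eq_bigr (fun=> miss_prob (2 ^+ n) k #|B|)); last first.
  by move=> x xB; rewrite (cardsD1 x B) (negbTE xB).
have cardBC : #|(fun x : bitstring n => x \notin B)|%:R = 2 ^+ n - #|B|%:R :> R.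
  have := cardC (mem B); rewrite card_tuple card_bool => cardB.
  by rewrite -natrX -cardB natrD addrC addKr; congr (_%:R); exact: eq_card.
by rewrite !sumr_const -!(mulr_natl (miss_prob _ _ _)) cardBC; field.
Qed.

Lemma prob_not_observed (k : nat) (B : {set bitstring n}) :
  P [set w | ~~ (B \subset observed X k w)] =
  (miss_prob (2 ^+ n) k #|B|)%:E.
Proof.
have := prob_missed [::] k B; rewrite expr0 mul1r => <-; congr (P _).
by apply/seteqP; split => w /=; rewrite subset_observed; [split|case].
Qed.

Lemma expected_collection_time (B : {set bitstring n}) :
  (\int[P]_w collection_time R X B w)%E =
  (2 ^+ n * harmonic_number R #|B|)%:E.
Proof.
have N1 : 1 <= 2 ^+ n :> R by rewrite exprn_ege1// ler1n.
have BN : #|B|%:R <= 2 ^+ n :> R.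
  by rewrite -natrX ler_nat -card_bool -card_tuple max_card.
under eq_integral do rewrite collection_timeE.
(* The terms are nonnegative, so expectation and series may be exchanged. *)
rewrite integral_nneseries//; last first.
  move=> k; apply/measurable_EFinP; exact: measurable_indic (measurable_not_observed _ _).
have -> : (\sum_(0 <= k <oo) \int[P]_w
      (\1_[set w | ~~ (B \subset observed X k w)] w)%:E =
    \sum_(0 <= k <oo) (miss_prob (2 ^+ n) k #|B|)%:E)%E.
  apply: eq_eseriesr => k _; rewrite -prob_not_observed.
  by rewrite integral_indic ?setIT//; exact: measurable_not_observed.
under eq_fun do rewrite sumEFin.
have /cvg_lim := cvg_sum_miss_prob _ _ _ N1 BN.
rewrite EFin_lim; first by move=> ->.
by apply/cvg_ex; eexists; exact: cvg_sum_miss_prob.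
Qed.

Lemma prob_observed_ge (B : {set bitstring n}) (delta : R) (M : nat) :
  B != finset.set0 -> 0 < delta -> 2 ^+ n * ln (#|B|%:R / delta) <= M%:R ->
  ((1 - delta)%:E <= P [set w | B \subset observed X M w])%E.
Proof.
move=> B0 delta0 leM.
have N0 : 0 < 2 ^+ n :> R by rewrite exprn_gt0.
have N1 : 1 <= 2 ^+ n :> R by rewrite exprn_ege1// ler1n.
have BN : #|B|%:R <= 2 ^+ n :> R.
  by rewrite -natrX ler_nat -card_bool -card_tuple max_card.
have m0 : 0 < #|B|%:R :> R by rewrite ltr0n card_gt0.
have -> : [set w | B \subset observed X M w] =
    ~` [set w | ~~ (B \subset observed X M w)].
  by apply/seteqP; split => w /=; [move=> ->|move/negP; rewrite negbK].
rewrite probability_setC; last exact: measurable_not_observed.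
rewrite prob_not_observed -EFinB lee_fin lerB//.
apply: le_trans (miss_prob_le _ _ _ _ N0 BN) _.
rewrite -ler_pdivlMl//.
have q0 : 0 <= 1 - (2 ^+ n)^-1 :> R by rewrite subr_ge0 invf_le1.
apply: (@le_trans _ _ (expR (- (2 ^+ n)^-1) ^+ M)).
  by rewrite lerXn2r ?nnegrE ?expR_ge0//; exact: expR_ge1Dx.
rewrite -expRM_natl.
rewrite -[leRHS]lnK ?posrE ?mulr_gt0 ?invr_gt0// ler_expR.
(* Writing the logarithm of delta / m as minus that of m / delta reduces the goal to ln (m / delta)
   <= M / N, which is the hypothesis on M. *)
rewrite -[X in ln X]invrK lnV ?posrE ?invr_gt0 ?mulr_gt0 ?invr_gt0//.
by rewrite mulrN lerN2 invfM invrK ler_pdivlMr// mulrC.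
Qed.
End draws.

(** * The lower bound on the number of shots, and the theorem *)

Lemma card_le_observed (R : realType) (n : nat) (T : Type)
    (X : nat -> T -> bitstring n) (B : {set bitstring n}) (M : nat) (w : T) :
  B \subset observed X M w -> (#|B| <= M)%N.
Proof.
move=> /subset_leq_card /leq_trans; apply.
by rewrite (leq_trans (leq_imset_card _ _))// card_ord.
Qed.

Theorem proposition2 (R : realType) :
  (forall (n : nat) (B : {set bitstring n}) (d : measure_display)
      (T : measurableType d) (P : probability T R)
      (X : nat -> {RV P >-> bitstring n}),
    (1 <= n)%N -> B != finset.set0 -> iid_uniform X ->
    (\int[P]_w collection_time R X B w)%E =
      (2 ^+ n * harmonic_number R #|B|)%:E
    /\
    (forall (delta : R) (M : nat),
      0 < delta < 1 -> 2 ^+ n * ln (#|B|%:R / delta) <= M%:R ->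
      ((1 - delta)%:E <= P [set w | B \subset observed X M w])%E))
  /\
  (forall (B : forall n : nat, {set bitstring n})
      (d : nat -> measure_display) (T : forall n : nat, measurableType (d n))
      (P : forall n : nat, probability (T n) R)
      (X : forall n : nat, nat -> {RV (P n) >-> bitstring n})
      (M : nat -> nat),
    (forall n : nat, (1 <= n)%N -> B n != finset.set0 /\ iid_uniform (X n)) ->
    (exists2 a : R, 1 < a & \forall n \near \oo, a ^+ n <= #|B n|%:R) ->
    non_negligible
      (fun n : nat => P n [set w | B n \subset observed (X n) (M n) w]) ->
    exists2 b : R, 1 < b & \forall n \near \oo, b ^+ n <= (M n)%:R).
Proof.
split.
  move=> n B d T P X _ B0 X_iid; split; first exact: expected_collection_time.
  by move=> delta M /andP[delta0 _]; exact: prob_observed_ge.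
(* The growth base of B also serves for M, because a^n <= |B n| <= M n for large n. *)
move=> B d T P X M _ [a a1 aB] [p pP]; exists a => //.
near=> n; have [p0 pn] : 0 < p.[n%:R] /\
    ((p.[n%:R]^-1)%:E <= P n [set w | B n \subset observed (X n) (M n) w])%E.
  by near: n.
have : (0 < P n [set w | B n \subset observed (X n) (M n) w])%E.
  by apply: lt_le_trans pn; rewrite lte_fin invr_gt0.
(* An event of positive probability is nonempty; any one of its points gives the deterministic bound
   |B n| <= M n. *)
have [->|/set0P[w /= Bw _]] := eqVneq [set w | B n \subset observed (X n) (M n) w] set0.
  by rewrite measure0 ltxx.
apply: (@le_trans _ _ #|B n|%:R); first by near: n.
by rewrite ler_nat; exact: card_le_observed Bw.
Unshelve. all: end_near. Qed.
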